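(* Let $m,n\ge 1$. If $C$ is any maximal configuration on the $m\times n$ grid, then $|C|\le E_{m,n}\le R_{m,n}$, where for fixed $n$ the sequence $(R_{k,n})_{k\ge 0}$ is defined by $R_{0,n}=0$, $R_{1,n}=n$, and $$R_{k,n}=R_{k-1,n}+n-\left\lfloor\frac{R_{k-1,n}-R_{k-2,n}}{3}\right\rfloor\quad\text{for } k\ge 2.$$
   Context: The $m\times n$ grid is $[m]\times[n]=\{(i,j):1\le i\le m,\ 1\le j\le n\}$; $(i,j)$ is the lot in row $i$ and column $j$, rows counted from the north (row $m$ southernmost) and columns from the west. A configuration is a subset $C\subseteq[m]\times[n]$ (the occupied lots); $|C|$ is its occupancy. A house at $(i,j)\in C$ is blocked from sunlight if $(i,j+1)$, $(i,j-1)$, $(i+1,j)$ all lie in the grid and are all occupied (lots outside the grid never obstruct sunlight). A configuration is permissible if no house in it is blocked; it is maximal if it is permissible and no permissible configuration strictly contains it. $E_{m,n}$ denotes the maximum of $|C|$ over all maximal configurations $C$ on the $m\times n$ grid. *)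

(* Defs.v *)
(* Rows and columns are 0-based: row 0 is the northernmost and
   column 0 the westernmost. *)
From mathcomp Require Import all_boot all_order all_algebra.

Set Implicit Arguments.
Unset Strict Implicit.
Unset Printing Implicit Defensive.

Import GRing.Theory Num.Theory.

(* The neighbours are named by existential witnesses in C rather than computed,
   so a neighbour outside the grid never counts as occupied. *)
Definition east_occupied (m n : nat) (C : {set 'I_m * 'I_n}) (p : 'I_m * 'I_n) : bool :=
  [exists q in C, (q.1 == p.1 :> nat) && (q.2 == p.2.+1 :> nat)].

Definition west_occupied (m n : nat) (C : {set 'I_m * 'I_n}) (p : 'I_m * 'I_n) : bool :=
  [exists q in C, (q.1 == p.1 :> nat) && (q.2.+1 == p.2 :> nat)].

Definition south_occupied (m n : nat) (C : {set 'I_m * 'I_n}) (p : 'I_m * 'I_n) : bool :=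
  [exists q in C, (q.1 == p.1.+1 :> nat) && (q.2 == p.2 :> nat)].

Definition blocked (m n : nat) (C : {set 'I_m * 'I_n}) (p : 'I_m * 'I_n) : bool :=
  [&& p \in C, east_occupied C p, west_occupied C p & south_occupied C p].

Definition permissible (m n : nat) (C : {set 'I_m * 'I_n}) : bool :=
  [forall p in C, ~~ blocked C p].

Definition maximal_config (m n : nat) (C : {set 'I_m * 'I_n}) : bool :=
  maxset (@permissible m n) C.

Definition E (m n : nat) : nat :=
  \max_(C : {set 'I_m * 'I_n} | maximal_config C) #|C|.

(* Valued in int, so that both subtractions are the true ones; divz by 3 is the
   floor. *)
Fixpoint R (k n : nat) : int :=
  match k with
  | 0 => 0%:Z
  | 1 => n%:Z
  | (k'.+1 as k1).+1 => (R k1 n + n%:Z - ((R k1 n - R k' n) %/ 3)%Z)%R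
  end.

(* Main.v *)
Require Import Defs.
From mathcomp Require Import all_boot all_order all_algebra.
From mathcomp Require Import zify.

Set Implicit Arguments.
Unset Strict Implicit.
Unset Printing Implicit Defensive.

(** If a row has [b] houses and the row directly north of it has [g] empty lots,
    then each of the at least [b - 2] houses off the side edges is within
    horizontal distance 1 of the column of one of those [g] lots, so
    [b - 2 <= 3 g], that is, [g >= floor (b / 3)].  Writing [S k] for the number
    of houses in the [k] southernmost rows, this reads
    [S (k + 2) <= S (k + 1) + n - floor ((S (k + 1) - S k) / 3)].  The right-hand
    side is nondecreasing in both [S (k + 1)] and [S k], hence [S k <= R k n]. *)

Section Rows.
Variables m n : nat.
Implicit Type C : {set 'I_m * 'I_n}.

Definition row_set C (i : 'I_m) : {set 'I_n} := [set j | (i, j) \in C].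

Definition south_count C (k : nat) : nat :=
  \sum_(i : 'I_m | m - k <= i) #|row_set C i|.

Lemma south_count0 C : south_count C 0 = 0.
Proof. by rewrite /south_count big_pred0 // => i; have := ltn_ord i; lia. Qed.

Lemma south_countS C (k : nat) (i : 'I_m) :
  i = m - k.+1 :> nat -> k < m ->
  south_count C k.+1 = south_count C k + #|row_set C i|.
Proof.
move=> ik km; rewrite /south_count (bigD1 i) /=; last by rewrite ik.
rewrite addnC; congr addn; apply: eq_bigl => j.
by rewrite -val_eqE /=; lia.
Qed.

Lemma south_count_full C : south_count C m = #|C|.
Proof.
rewrite /south_count (eq_bigl xpredT); last by move=> i; rewrite subnn.
under eq_bigr => i _ do rewrite -sum1_card.
rewrite pair_big_dep /= -sum1_card; apply: eq_bigl => -[i j] /=.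
by rewrite inE.
Qed.

End Rows.

(** Applied with [A] a row and [B] the row directly south of it. *)
Lemma card_shaded_row (n : nat) (A B : {set 'I_n}) : 0 < n ->
  (forall j0 j j1 : 'I_n, j = j0.+1 :> nat -> j1 = j.+1 :> nat ->
    j0 \in A -> j \in A -> j1 \in A -> j \notin B) ->
  #|B| <= 3 * (n - #|A|) + 2.
Proof.
case: n A B => // n A B _ AB.
set G := ~: A.
have cG : #|G| = n.+1 - #|A| by rewrite cardsCs setCK card_ord.
(* [D] covers [B] by the gaps of [A], their two cyclic shifts and the end columns. Off the ends,
   [ordS] and [ord_pred] do not wrap around and give the true neighbours. *)
pose D := G :|: @ordS n.+1 @: G :|: @ord_pred n.+1 @: G :|: [set ord0; ord_max].
have BD : B \subset D.
  apply/subsetP => j jB; apply/negPn/negP; rewrite !inE !negb_or negbK.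
  case/andP => /andP[/andP[jA jS] jP] /andP[j0 jM].
  have pA : ord_pred j \in A.
    apply: contraNT jS => h; apply/imsetP; exists (ord_pred j).
      by rewrite inE.
    by rewrite ord_predK.
  have sA : ordS j \in A.
    apply: contraNT jP => h; apply/imsetP; exists (ordS j).
      by rewrite inE.
    by rewrite ordSK.
  move: j0 jM; rewrite -!val_eqE /= => j0 jM; have jn := ltn_ord j.
  have ps : j = (ord_pred j).+1 :> nat.
    rewrite /= (_ : (j + n.+1).-1 = j.-1 + n.+1); last by lia.
    by rewrite modnDr modn_small; lia.
  have ss : ordS j = j.+1 :> nat by rewrite /= modn_small; lia.
  by have := AB _ _ _ ps ss pA jA sA; rewrite jB.
have cardU (X Y : {set 'I_n.+1}) : #|X :|: Y| <= #|X| + #|Y|.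
  by have [] := leq_card_setU X Y.
rewrite -cG; apply: leq_trans (subset_leq_card BD) _.
rewrite (_ : 3 * #|G| = #|G| + #|G| + #|G|); last by lia.
apply: leq_trans (cardU _ _) _; rewrite leq_add //; last first.
  by rewrite cards2; case: (_ == _).
apply: leq_trans (cardU _ _) _; rewrite leq_add ?leq_imset_card //.
by apply: leq_trans (cardU _ _) _; rewrite leq_add ?leq_imset_card.
Qed.

(** A house at [(i', j)] would close the only side of [(i, j)] still open to sunlight. *)
Lemma permissible_row_set (m n : nat) (C : {set 'I_m * 'I_n}) (i i' : 'I_m) :
  permissible C -> i' = i.+1 :> nat ->
  forall j0 j j1 : 'I_n, j = j0.+1 :> nat -> j1 = j.+1 :> nat ->
  j0 \in row_set C i -> j \in row_set C i -> j1 \in row_set C i ->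
  j \notin row_set C i'.
Proof.
move=> /forall_inP pC ii j0 j j1 jj0 j1j; rewrite !inE => h0 h h1.
apply: contra (pC _ h) => h'; rewrite /blocked h /=; apply/and3P; split.
- by apply/exists_inP; exists (i, j1) => //=; rewrite eqxx j1j /=.
- by apply/exists_inP; exists (i, j0) => //=; rewrite eqxx jj0 /=.
- by apply/exists_inP; exists (i', j) => //=; rewrite ii !eqxx.
Qed.

Lemma south_count_le (m n : nat) (C : {set 'I_m * 'I_n}) (k : nat) :
  0 < n -> permissible C -> k <= m -> ((south_count C k)%:Z <= R k n)%R.
Proof.
move=> n0 pC; have card_le (B : {set 'I_n}) : #|B| <= n.
  by rewrite -[X in _ <= X]card_ord max_card.
(* Strong induction, since the recurrence reaches back two terms. *)
elim/ltn_ind: k => -[|[|k]] IH km; first by rewrite south_count0.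
  have i_lt : m - 1 < m by lia.
  rewrite (@south_countS _ _ _ _ (Ordinal i_lt)) // south_count0 /=.
  exact: card_le.
have i_lt : m - k.+2 < m by lia.
have i'_lt : m - k.+1 < m by lia.
pose i := Ordinal i_lt; pose i' := Ordinal i'_lt.
have eS1 : south_count C k.+1 = _ := @south_countS _ _ C k i' erefl ltac:(lia).
have eS2 : south_count C k.+2 = _ := @south_countS _ _ C k.+1 i erefl ltac:(lia).
have ii : i' = i.+1 :> nat by rewrite /=; lia.
have := card_shaded_row n0 (permissible_row_set pC ii).
(* Makes the truncated [n - #|row_set C i|] a true difference. *)
have := card_le (row_set C i).
have := IH k ltac:(lia) ltac:(lia).
have := IH k.+1 ltac:(lia) ltac:(lia).
rewrite [R k.+2 n]/= -/(R k.+1 n).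
(* The floor falls as [r] grows, and rises by at most [t] when [r1] grows by [t], so both induction
   bounds can be substituted. *)
move: (R k n) (R k.+1 n) eS1 eS2 => r r1; lia.
Qed.

Theorem theorem4p12 (m n : nat) (hm : (1 <= m)%N) (hn : (1 <= n)%N)
    (C : {set 'I_m * 'I_n}) (hC : maximal_config C) :
  (#|C| <= E m n)%N /\ ((E m n)%:Z <= R m n)%R.
Proof.
split; first exact: leq_bigmax_cond.
(* [C] shows that the maximum ranges over a nonempty family, so some maximal [D] attains it. *)
rewrite /E; have [D hD ->] := eq_bigmax_cond (fun D : {set 'I_m * 'I_n} => #|D|)
  (introT card_gt0P (ex_intro _ C hC)).
rewrite -south_count_full; apply: south_count_le => //.
exact: maxsetp hD.
Qed.
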